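(* There is an absolute constant $c>0$ such that the following holds for every graph $G$, label set $\chi$ with $d\ge2$, cost vector $C$ and $\epsilon>0$. Set $\eta=\frac{4(m+n)\log d}{\epsilon}$ and let $K\ge c\, m d^2(m+n)^4\|C\|_\infty^3\epsilon^{-3}\log d$. Let $\hat\lambda$ be the output of the randomized message passing procedure run for $K$ iterations with the EMP update and block distribution uniform over $\{(e,i):e\in E,i\in e\}$, and let $\hat\mu=\mathrm{Proj}(\mu^{\hat\lambda})$. Then $\hat\mu\in\mathbb{L}_2$ and $$\mathbb{E}\,\langle C,\hat\mu\rangle\le\min_{\mu\in\mathbb{L}_2}\langle C,\mu\rangle+\epsilon.$$ The same conclusion holds if instead the procedure uses the SMP update with vertex $i$ sampled with probability $p_i=|N_i|/\sum_{j\in V}|N_j|$.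
   Context: Let $G=(V,E)$ be a finite undirected graph with $n=|V|$, $m=|E|$, every vertex incident to at least one edge; $N_i=\{e\in E:i\in e\}$. $\chi$ is a finite label set with $d=|\chi|\ge2$. Costs $C_i\in\mathbb{R}^\chi$, $C_e\in\mathbb{R}^{\chi^2}$; $\|C\|_\infty$ is the largest absolute entry; for $e=\{i,j\}$ (with a fixed orientation), $x_e=(x_i,x_j)$ and $(x_e)_i=x_i$. $\langle C,\mu\rangle=\sum_i\sum_xC_i(x)\mu_i(x)+\sum_e\sum_{x_e}C_e(x_e)\mu_e(x_e)$. $\mathbb{L}_2=\{\mu\ge0:\mu_i\in\Sigma^d\ \forall i,\ \sum_{x_e:(x_e)_i=x}\mu_e(x_e)=\mu_i(x)\ \forall e,\,i\in e,\,x\}$, with $\Sigma^d$ the probability simplex on $\chi$. Dual variables $\lambda\in\mathbb{R}^{2md}$ indexed by $(e,i,x)$, $e\in E$, $i\in e$, $x\in\chi$. $\mu^\lambda_i(x)\propto\exp(-\eta C_i(x)+\eta\sum_{e\in N_i}\lambda_{e,i}(x))$, $\mu^\lambda_e(x_e)\propto\exp(-\eta C_e(x_e)-\eta\sum_{i\in e}\lambda_{e,i}((x_e)_i))$, each normalized to sum to $1$; $S^\lambda_{e,i}(x)=\sum_{x_e:(x_e)_i=x}\mu^\lambda_e(x_e)$; slack $\nu^\lambda_{e,i}=S^\lambda_{e,i}-\mu^\lambda_i$. EMP update at block $(e,i)$: replace $\lambda_{e,i}(x)$ by $\lambda_{e,i}(x)+\frac{1}{2\eta}\log(S^\lambda_{e,i}(x)/\mu^\lambda_i(x))$.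 SMP update at vertex $i$: for each $e\in N_i$ replace $\lambda_{e,i}(x)$ by $\lambda_{e,i}(x)+\frac1\eta\log S^\lambda_{e,i}(x)-\frac{1}{\eta(|N_i|+1)}\log(\mu^\lambda_i(x)\prod_{e'\in N_i}S^\lambda_{e',i}(x))$. Randomized message passing procedure: $\lambda^{(0)}=0$; for $k=0,\dots,K-1$, sample a block $b_k$ independently from the given distribution and let $\lambda^{(k+1)}$ be $\lambda^{(k)}$ with block $b_k$ updated by the update rule evaluated at $\lambda^{(k)}$; output $\hat\lambda\in\arg\min_{\lambda\in\{\lambda^{(0)},\dots,\lambda^{(K)}\}}\sum_{e\in E,i\in e}\|\nu^\lambda_{e,i}\|_1^2$. Rounding map: for $F\in\mathbb{R}_{>0}^{\chi\times\chi}$ and $r,c\in\Sigma^d$, with $r(F),c(F)$ the row/column sums, let $F'=\mathrm{diag}(a)F$ with $a(x)=\min\{r(x)/r(F)(x),1\}$, $F''=F'\mathrm{diag}(b)$ with $b(x)=\min\{c(x)/c(F')(x),1\}$, $\mathrm{err}_r=r-r(F'')$, $\mathrm{err}_c=c-c(F'')$, and output $F''+\mathrm{err}_r\mathrm{err}_c^\top/\|\mathrm{err}_c\|_1$ (or $F''$ if $\mathrm{err}_c=0$). $\mathrm{Proj}(\mu^\lambda)$ is the vector $\hat\mu$ with $\hat\mu_i=\mu^\lambda_i$ for $i\in V$ and, for $e=\{i,j\}$, $\hat\mu_e$ the rounding of $\mu^\lambda_e$ (rows indexed by $x_i$, columns by $x_j$) with $r=\mu^\lambda_i$, $c=\mu^\lambda_j$.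 Expectation is over the random block choices. *)

(* Defs.v *)
From HB Require Import structures.
From mathcomp Require Import all_boot all_order all_algebra.
From mathcomp Require Import all_classical all_reals all_analysis.
From mathcomp Require Import Rstruct Rstruct_topology.
Set Implicit Arguments. Unset Strict Implicit. Unset Printing Implicit Defensive.
Import Order.TTheory GRing.Theory Num.Theory.
Local Open Scope ring_scope.

(* Graph: vertex type V, edge type E, each edge e = {src e, tgt e} with the
   fixed orientation (src e, tgt e).  A block (e,i) with i in e is encoded as
   (e, b) : E * bool, with i = endp e b (b = false: src, b = true: tgt). *)

Section MP.
Variable R : realType.
Variables (V E chi : finType) (src tgt : E -> V).

Definition graph_ok : Prop :=
  [/\ (forall e, src e != tgt e),
      (forall e e', [set src e; tgt e] = [set src e'; tgt e'] -> e = e')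
    & (forall v, exists e, (src e == v) || (tgt e == v))].

Definition endp (e : E) (b : bool) : V := if b then tgt e else src e.

Definition nbr (i : V) : nat := #|[set e : E | (src e == i) || (tgt e == i)]|.

Definition lam := E -> bool -> chi -> R.

Variables (Ci : V -> chi -> R) (Ce : E -> chi -> chi -> R) (eta : R).

Definition Cinf : R :=
  Num.max (\big[Num.max/0]_(p : V * chi) `|Ci p.1 p.2|)
          (\big[Num.max/0]_(p : E * chi * chi) `|Ce p.1.1 p.1.2 p.2|).

Definition muV (l : lam) (i : V) (x : chi) : R :=
  let w z := expR (- eta * Ci i z
                   + eta * \sum_(p : E * bool | endp p.1 p.2 == i) l p.1 p.2 z) in
  w x / \sum_z w z.

Definition muE (l : lam) (e : E) (x y : chi) : R :=
  let w u v := expR (- eta * Ce e u v - eta * (l e false u + l e true v)) in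
  w x y / \sum_u \sum_v w u v.

Definition Smarg (l : lam) (e : E) (b : bool) (x : chi) : R :=
  if b then \sum_y muE l e y x else \sum_y muE l e x y.

Definition slack (l : lam) (e : E) (b : bool) (x : chi) : R :=
  Smarg l e b x - muV l (endp e b) x.

Definition emp_update (blk : E * bool) (l : lam) : lam :=
  fun e b x =>
    if (e, b) == blk then
      l e b x + (2 * eta)^-1 * ln (Smarg l e b x / muV l (endp e b) x)
    else l e b x.

Definition smp_update (i : V) (l : lam) : lam :=
  fun e b x =>
    if endp e b == i then
      l e b x + eta^-1 * ln (Smarg l e b x)
      - (eta * ((nbr i)%:R + 1))^-1
        * ln (muV l i x * \prod_(p : E * bool | endp p.1 p.2 == i) Smarg l p.1 p.2 x)
    else l e b x.

Definition objective (l : lam) : R :=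
  \sum_(p : E * bool) (\sum_x `|slack l p.1 p.2 x|) ^+ 2.

Definition lam0 : lam := fun _ _ _ => 0.

Definition traj (B : Type) (upd : B -> lam -> lam) (s : seq B) (k : nat) : lam :=
  foldl (fun l b => upd b l) lam0 (take k s).

Definition round (F : chi -> chi -> R) (r c : chi -> R) : chi -> chi -> R :=
  let a x := Num.min (r x / \sum_y F x y) 1 in
  let F1 x y := a x * F x y in
  let bb y := Num.min (c y / \sum_x F1 x y) 1 in
  let F2 x y := F1 x y * bb y in
  let er x := r x - \sum_y F2 x y in
  let ec y := c y - \sum_x F2 x y in
  if [forall y, ec y == 0] then F2
  else fun x y => F2 x y + er x * ec y / \sum_z `|ec z|.

Definition projV (l : lam) : V -> chi -> R := muV l.
Definition projE (l : lam) : E -> chi -> chi -> R :=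
  fun e => round (muE l e) (muV l (src e)) (muV l (tgt e)).

Definition inL2 (mv : V -> chi -> R) (me : E -> chi -> chi -> R) : Prop :=
  [/\ (forall i x, 0 <= mv i x),
      (forall e x y, 0 <= me e x y),
      (forall i, \sum_x mv i x = 1),
      (forall e x, \sum_y me e x y = mv (src e) x)
    & (forall e y, \sum_x me e x y = mv (tgt e) y)].

Definition cost (mv : V -> chi -> R) (me : E -> chi -> chi -> R) : R :=
  \sum_i \sum_x Ci i x * mv i x + \sum_e \sum_x \sum_y Ce e x y * me e x y.

Definition expect (B : finType) (p : B -> R) (K : nat) (f : K.-tuple B -> R) : R :=
  \sum_(s : K.-tuple B) (\prod_(k < K) p (tnth s k)) * f s.

Definition mp_guarantee (B : finType) (upd : B -> lam -> lam) (p : B -> R)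
    (K : nat) (eps : R) : Prop :=
  forall sel : K.-tuple B -> 'I_K.+1,
    (forall (s : K.-tuple B) (j : 'I_K.+1),
        objective (traj upd s (sel s)) <= objective (traj upd s j)) ->
    (forall s : K.-tuple B, inL2 (projV (traj upd s (sel s))) (projE (traj upd s (sel s))))
    /\ (forall mv me, inL2 mv me ->
          expect p (fun s => cost (projV (traj upd s (sel s)))
                                  (projE (traj upd s (sel s))))
          <= cost mv me + eps).

End MP.

(* Main.v *)
Require Import Defs.
From HB Require Import structures.
From mathcomp Require Import all_boot all_order all_algebra.
From mathcomp Require Import all_classical all_reals all_analysis.
From mathcomp Require Import Rstruct Rstruct_topology.
From mathcomp Require Import ring lra.
Set Implicit Arguments. Unset Strict Implicit.
Import Order.TTheory GRing.Theory Num.Theory.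
Local Open Scope ring_scope.

(* Both updates are block coordinate descent steps on the dual of the entropy-
   regularized problem.  An EMP step at (e, i) lowers the dual, rescaled by eta,
   by minus twice the logarithm of a Bhattacharyya coefficient, hence by at
   least |nu_{e,i}|_1^2 / 4; an SMP step at i lowers it at least as much as the
   EMP step at any block (e, i), by Hoelder's inequality.  With either sampling
   rule the expected decrease is thus at least objective / (8 m), and since the
   dual stays in an interval of length O(eta (m + n) |C|), the expected
   objective of the best iterate is O(m eta (m + n) |C| / K).
   The primal gap is controlled by a competitor with the same slack as mu^l:
   a given point of L_2 is mixed with weight 2 d s with the uniform point, where
   s^2 is the objective, so that the slack can be added to the edge marginals
   without losing positivity.  The multipliers cancel in the comparison, the
   entropies cost eps / 2, and the competitor and the rounding cost
   8 (m + n) d s |C|, which is at most eps / 4 plus a multiple of the objective. *)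

(** * Entropy inequalities *)

Section Inequalities.
Variable R : realType.

Lemma ln_le_sub1 (x : R) : 0 < x -> ln x <= x - 1.
Proof. by move=> x0; rewrite -{1}(subrKC 1 x) le_ln1Dx//; lra. Qed.

Lemma sum_cst (T : finType) (u : R) : \sum_(x : T) u = #|T|%:R * u.
Proof. by rewrite sumr_const -[LHS]mulr_natl. Qed.

(** [p] witnesses that [T] is inhabited: an empty sum could not equal 1. *)
Lemma sum1_gt0 (T : finType) (p w : T -> R) :
  \sum_x p x = 1 -> (forall x, 0 < w x) -> 0 < \sum_x w x.
Proof.
move=> p1 w0; case: (pickP (fun _ : T => true)) => [x _|T0]; last first.
  by move: p1; rewrite big_pred0// => /esym/eqP; rewrite oner_eq0.
by rewrite (bigD1 x)//= ltr_wpDr// sumr_ge0// => y _; exact: ltW.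
Qed.

Lemma gibbs (T : finType) (p w : T -> R) :
  (forall x, 0 <= p x) -> \sum_x p x = 1 -> (forall x, 0 < w x) ->
  \sum_x p x * (ln (w x) - ln (p x)) <= ln (\sum_x w x).
Proof.
move=> p0 p1 w0; have W0 := sum1_gt0 p1 w0.
set W := \sum_x w x in W0 *.
(* The added terms [w x / W - p x] sum to zero and make the bound hold term by term, from
   [ln u <= u - 1] at [u = w x / (W * p x)]. *)
have -> : ln W = \sum_x (p x * ln W + (w x / W - p x)).
  rewrite big_split/= -mulr_suml p1 mul1r sumrB p1 -mulr_suml divff ?gt_eqF//.
  by rewrite subrr addr0.
apply: ler_sum => x _; have := p0 x; rewrite le_eqVlt => /orP[/eqP <-|px].
  by rewrite !mul0r add0r subr0 divr_ge0 ?ltW.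
have := ln_le_sub1 (divr_gt0 (divr_gt0 (w0 x) W0) px).
rewrite ln_div ?posrE ?divr_gt0// ln_div ?posrE// => /(ler_wpM2l (ltW px)).
have -> : p x * (w x / W / p x - 1) = w x / W - p x.
  by field; rewrite !gt_eqF.
lra.
Qed.

(** Drops from [gibbs] the entropy of [p], nonnegative since each [p x] is at most 1. *)
Lemma gibbs_ge (T : finType) (p w : T -> R) :
  (forall x, 0 <= p x) -> \sum_x p x = 1 -> (forall x, 0 < w x) ->
  \sum_x p x * ln (w x) <= ln (\sum_x w x).
Proof.
move=> p0 p1 w0; apply: le_trans (gibbs p0 p1 w0).
apply: ler_sum => x _; rewrite mulrBr lerDl oppr_ge0.
rewrite mulr_ge0_le0// ln_le0// -p1 (bigD1 x)//= lerDl.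
exact: sumr_ge0.
Qed.

(** The softmax attains equality in [gibbs], so only its entropy is lost; [gibbs] with unit weights
    bounds that entropy. *)
Lemma gibbs_softmax (T : finType) (w : T -> R) : (0 < #|T|)%N ->
  (forall x, 0 < w x) ->
  ln (\sum_x w x) <= \sum_x w x / (\sum_z w z) * ln (w x) + ln #|T|%:R.
Proof.
move=> T0 w0; have W0 : 0 < \sum_x w x.
  apply: (sum1_gt0 (p := fun=> #|T|%:R^-1)) => //.
  by rewrite sum_cst divff// pnatr_eq0 -lt0n.
set W := \sum_x w x in W0 *.
have p1 : \sum_x w x / W = 1 by rewrite -mulr_suml divff// gt_eqF.
have := gibbs (p := fun x => w x / W) (w := fun=> 1)
  (fun x => ltW (divr_gt0 (w0 x) W0)) p1 (fun=> ltr01).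
rewrite sumr_const.
have -> : \sum_x w x / W * (ln 1 - ln (w x / W)) =
    ln W - \sum_x w x / W * ln (w x).
  rewrite -[in RHS](mul1r (ln W)) -[X in X * ln W]p1 mulr_suml -sumrB.
  by apply: eq_bigr => x _; rewrite ln1 ln_div ?posrE//; ring.
by rewrite lerBlDl.
Qed.

(** Factoring [p - q = (a - b) * (a + b)] through square roots bounds the L1 distance by the
    Bhattacharyya coefficient [Z]; then [ln Z <= Z - 1]. *)
Lemma hellinger (T : finType) (p q : T -> R) :
  (forall x, 0 < p x) -> \sum_x p x = 1 ->
  (forall x, 0 < q x) -> \sum_x q x = 1 ->
  2 * ln (\sum_x expR ((ln (p x) + ln (q x)) / 2))
    <= - ((\sum_x `|p x - q x|) ^+ 2 / 4).
Proof.
move=> p0 p1 q0 q1.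
pose a x := expR (ln (p x) / 2); pose b x := expR (ln (q x) / 2).
have pE x : p x = a x ^+ 2 by rewrite -expRM_natr mulfVK ?pnatr_eq0// lnK ?posrE.
have qE x : q x = b x ^+ 2 by rewrite -expRM_natr mulfVK ?pnatr_eq0// lnK ?posrE.
rewrite (eq_bigr (fun x => a x * b x)); last by move=> x _; rewrite -exp.expRD mulrDl.
set Z := \sum_x a x * b x.
have Z0 : 0 < Z by apply: (sum1_gt0 p1) => x; rewrite mulr_gt0 ?expR_gt0.
have dE : \sum_x (a x - b x) ^+ 2 = 2 - 2 * Z.
  have -> : 2 - 2 * Z = \sum_x p x + \sum_x q x - 2 * Z by rewrite p1 q1; ring.
  rewrite mulr_sumr -big_split -sumrB.
  by apply: eq_bigr => x _; rewrite /= pE qE; ring.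
have sE : \sum_x (a x + b x) ^+ 2 = 2 + 2 * Z.
  have -> : 2 + 2 * Z = \sum_x p x + \sum_x q x + 2 * Z by rewrite p1 q1; ring.
  rewrite mulr_sumr -!big_split.
  by apply: eq_bigr => x _; rewrite /= pE qE; ring.
have d0 : 0 <= 2 - 2 * Z by rewrite -dE sumr_ge0// => x _; exact: sqr_ge0.
set D := \sum_x `|p x - q x|.
have D0 : 0 <= D by apply: sumr_ge0.
suff : D ^+ 2 <= 8 * (1 - Z) by have := ln_le_sub1 Z0; lra.
move: D0; rewrite le_eqVlt => /orP[/eqP <-|D0]; first by rewrite expr0n/=; lra.
(* AM-GM: |p - q| = |a - b| (a + b) <= 2/D (a - b)^2 + D/8 (a + b)^2 *)
have : D <= 2 / D * (2 - 2 * Z) + D / 8 * (2 + 2 * Z).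
  rewrite -dE -sE !mulr_sumr -big_split; apply: ler_sum => x _ /=.
  rewrite pE qE subr_sqr normrM (ger0_norm (_ : 0 <= a x + b x)); last first.
    by rewrite addr_ge0 ?expR_ge0.
  rewrite -[(a x - b x) ^+ 2]real_normK ?num_real//.
  set u := `|_|; set v := a x + b x.
  rewrite -subr_ge0.
  have -> : 2 / D * u ^+ 2 + D / 8 * v ^+ 2 - u * v =
     (4 * u - D * v) ^+ 2 / (8 * D) by field; rewrite gt_eqF.
  by rewrite divr_ge0 ?sqr_ge0// mulr_ge0// ltW.
rewrite -(ler_pM2l D0).
have -> : D * (2 / D * (2 - 2 * Z) + D / 8 * (2 + 2 * Z)) =
  4 * (1 - Z) + D ^+ 2 * (1 + Z) / 4 by field; rewrite gt_eqF.
(* As [Z <= 1], moving the last term to the left leaves [D ^+ 2] a coefficient [(3 - Z) / 4], at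
   least [1 / 2]. *)
have := sqr_ge0 D; rewrite -expr2; nra.
Qed.

(* Hoelder's inequality in logarithmic form, obtained by testing Gibbs'
   inequality against the normalized geometric mean. *)
Lemma ln_sum_geo_mean_le (T I : finType) (P : pred I) (q : T -> R)
    (S : I -> T -> R) (j : I) (N : R) : P j -> N = \sum_(k | P k) 1 ->
  (forall x, 0 < q x) -> \sum_x q x = 1 ->
  (forall k x, 0 < S k x) -> (forall k, \sum_x S k x = 1) ->
  (N + 1) * ln (\sum_x expR ((ln (q x) + \sum_(k | P k) ln (S k x)) / (N + 1)))
    <= 2 * ln (\sum_x expR ((ln (q x) + ln (S j x)) / 2)).
Proof.
move=> Pj NE q0 q1 S0 S1.
pose L x := (ln (q x) + \sum_(k | P k) ln (S k x)) / (N + 1).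
have N0 : 0 <= N by rewrite NE; apply: sumr_ge0.
have Z0 : 0 < \sum_x expR (L x) by apply: (sum1_gt0 q1) => x; exact: expR_gt0.
set Z := \sum_x expR (L x) in Z0; rewrite -/Z.
pose g x := expR (L x) / Z.
have g0 x : 0 < g x by rewrite divr_gt0// expR_gt0.
have g1 : \sum_x g x = 1 by rewrite -mulr_suml divff// gt_eqF.
have lng x : ln (g x) = L x - ln Z by rewrite ln_div ?posrE ?expR_gt0// expRK.
pose A := \sum_x g x * ln (q x).
pose B k := \sum_x g x * ln (S k x).
(* [H] is the entropy of [g], the Gibbs distribution of [L]; hence the equality [total]. *)
pose H := \sum_x g x * (ln Z - L x).
have total : A + \sum_(k | P k) B k + (N + 1) * H = (N + 1) * ln Z.
  rewrite exchange_big mulr_sumr -!big_split/=.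
  rewrite -[RHS]mulr1 -[X in _ = _ * X]g1 mulr_sumr; apply: eq_bigr => x _.
  rewrite -mulr_sumr -mulrDr.
  have -> : ln (q x) + \sum_(k | P k) ln (S k x) = (N + 1) * L x.
    by rewrite mulrC mulfVK// gt_eqF// ltr_wpDl.
  ring.
have pair : (A + B j) / 2 + H <= ln (\sum_x expR ((ln (q x) + ln (S j x)) / 2)).
  have := gibbs (w := fun x => expR ((ln (q x) + ln (S j x)) / 2))
    (fun x => ltW (g0 x)) g1 (fun x => expR_gt0 _).
  apply: le_trans; rewrite le_eqVlt; apply/orP; left; apply/eqP.
  rewrite mulrDl !mulr_suml -!big_split/=; apply: eq_bigr => x _.
  by rewrite expRK lng; field.
have one k : B k + H <= 0.
  have := gibbs (fun x => ltW (g0 x)) g1 (S0 k).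
  rewrite S1 ln1; apply: le_trans; rewrite -big_split/= le_eqVlt.
  by apply/orP; left; apply/eqP/eq_bigr => x _; rewrite lng; ring.
(* As [N + 1 = 2 + (N - 1)], the total is twice the left side of [pair] plus the nonpositive terms
   of [one] for [k != j]. *)
rewrite -total NE (bigD1 j)//= [\sum_(k | P k) 1](bigD1 j)//=.
have : \sum_(k | P k && (k != j)) (B k + H) <= 0.
  rewrite -oppr_ge0 -sumrN; apply: sumr_ge0 => k _; have := one k; lra.
rewrite big_split/=.
have -> : \sum_(k | P k && (k != j)) H = (\sum_(k | P k && (k != j)) 1) * H.
  by rewrite mulr_suml; apply: eq_bigr => k _; rewrite mul1r.
nra.
Qed.

End Inequalities.

(** * Expectation over block sequences *)

Section Expectation.
Variables (R : realType) (B : finType) (p : B -> R).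

Lemma expect0 (f : 0.-tuple B -> R) : expect p f = f [tuple].
Proof.
rewrite /expect (big_pred1 [tuple]) ?big_ord0 ?mul1r// => s /=.
exact/esym/eqP/tuple0.
Qed.

(** Conditioning on the first block, which is also the first that [foldl] applies. *)
Lemma expect_cons K (f : K.+1.-tuple B -> R) :
  expect p f = \sum_b p b * expect p (fun t : K.-tuple B => f (cons_tuple b t)).
Proof.
rewrite /expect (reindex (fun bt : B * K.-tuple B => cons_tuple bt.1 bt.2)) /=.
  rewrite -(pair_bigA _ (fun b (t : K.-tuple B) =>
    \prod_k p (tnth (cons_tuple b t) k) * f (cons_tuple b t)))/=.
  apply: eq_bigr => b _; rewrite mulr_sumr; apply: eq_bigr => t _.
  rewrite big_ord_recl mulrA tnth0; congr (_ * _ * _).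
  by apply: eq_bigr => k _; rewrite tnthS.
exists (fun s => (thead s, [tuple of behead s])) => [[b t] _|s _] /=.
  by congr (_, _); apply: val_inj.
by apply: val_inj; rewrite /= -[RHS]/(val s) [in RHS](tuple_eta s).
Qed.

Lemma expectD K (f g : K.-tuple B -> R) :
  expect p (fun s => f s + g s) = expect p f + expect p g.
Proof. by rewrite /expect -big_split; apply: eq_bigr => s _; rewrite mulrDr. Qed.

Lemma expectZ K c (f : K.-tuple B -> R) :
  expect p (fun s => c * f s) = c * expect p f.
Proof. by rewrite /expect mulr_sumr; apply: eq_bigr => s _; rewrite mulrCA. Qed.

Hypotheses (p0 : forall b, 0 <= p b) (p1 : \sum_b p b = 1).

Lemma expect_le K (f g : K.-tuple B -> R) :
  (forall s, f s <= g s) -> expect p f <= expect p g.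
Proof.
by move=> fg; apply: ler_sum => s _; rewrite ler_wpM2l// prodr_ge0.
Qed.

Lemma expect_cst K c : expect p (fun=> c : R) (K := K) = c.
Proof.
elim: K => [|K IH]; first by rewrite expect0.
by rewrite expect_cons; under eq_bigr do rewrite IH; rewrite -mulr_suml p1 mul1r.
Qed.

(** Telescoping. The starting point is general because the induction peels off the first update; the
    sum runs over the iterates before each update. *)
Lemma expect_drift (T : Type) (upd : B -> T -> T) (pot obj : T -> R) :
  (forall l, \sum_b p b * pot (upd b l) + obj l <= pot l) ->
  forall K l0,
  expect p (fun s : K.-tuple B => pot (foldl (fun l b => upd b l) l0 s)
     + \sum_(k < K) obj (foldl (fun l b => upd b l) l0 (take k s))) <= pot l0.
Proof.
move=> drift; elim=> [|K IH] l0; first by rewrite expect0 big_ord0 addr0.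
rewrite expect_cons; apply: le_trans (drift l0).
rewrite -[obj l0]mul1r -p1 mulr_suml -big_split; apply: ler_sum => b _ /=.
rewrite -mulrDr ler_wpM2l//.
under eq_fun do rewrite big_ord_recl/= addrCA.
by rewrite expectD expect_cst addrC lerD2r; exact: IH.
Qed.

End Expectation.

(** * The dual objective and its descent *)

Section Dual.
Variables (R : realType) (V E chi : finType) (src tgt : E -> V).
Variables (Ci : V -> chi -> R) (Ce : E -> chi -> chi -> R) (eta : R).
Hypothesis no_loop : forall e, src e != tgt e.
Hypothesis chi_gt0 : (0 < #|chi|)%N.

Local Notation lam := (lam R E chi).
Local Notation endp := (endp src tgt).
Local Notation muV := (muV src tgt Ci eta).
Local Notation muE := (muE Ce eta).
Local Notation Smarg := (Smarg Ce eta).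
Local Notation slack := (slack src tgt Ci Ce eta).
Local Notation cost := (cost Ci Ce).
Local Notation Cinf := (Cinf Ci Ce).

Definition marg (F : chi -> chi -> R) (b : bool) (x : chi) : R :=
  if b then \sum_y F y x else \sum_y F x y.

(** The logits of [muV], followed by those of [muE]: both distributions are convertible to softmaxes
    of them. *)
Definition expoV (l : lam) i z : R :=
  - eta * Ci i z + eta * \sum_(p : E * bool | endp p.1 p.2 == i) l p.1 p.2 z.

Definition expoE (l : lam) e u v : R :=
  - eta * Ce e u v - eta * (l e false u + l e true v).

(* eta times the dual objective; its partial derivative in the coordinate
   (e, b, x) is [- eta * slack l e b x]. *)
Definition pot (l : lam) : R :=
  \sum_i ln (\sum_z expR (expoV l i z))
  + \sum_e ln (\sum_u \sum_v expR (expoE l e u v)).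

Lemma sum_blocks (P : pred (E * bool)) (F : E * bool -> R) :
  \sum_(p | P p) F p = \sum_e \sum_(b | P (e, b)) F (e, b).
Proof. by rewrite pair_big_dep/=; apply: eq_big => [[]|[]]. Qed.

Lemma sum_blocks_at (F : E * bool -> R) :
  \sum_p F p = \sum_i \sum_(p | endp p.1 p.2 == i) F p.
Proof. exact: (partition_big (fun p => endp p.1 p.2) xpredT). Qed.

(** [nbr] counts edges, the sum counts blocks; without loops an edge has at most one block at
    [i]. *)
Lemma nbrE i : (nbr src tgt i)%:R = \sum_(p | endp p.1 p.2 == i) 1 :> R.
Proof.
rewrite sum_blocks /nbr -sum1_card natr_sum big_mkcond; apply: eq_bigr => e _ /=.
rewrite inE big_mkcond big_bool/= addrC.
have := no_loop e; case: (eqVneq (src e) i) => [->|_]/=; last first.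
  by case: ifP; rewrite add0r.
by rewrite eq_sym => /negPf ->; rewrite addr0.
Qed.

Lemma sum_expR_gt0 (f : chi -> R) : 0 < \sum_z expR (f z).
Proof.
apply: (sum1_gt0 (p := fun=> #|chi|%:R^-1)) => [|x]; last exact: expR_gt0.
by rewrite sum_cst divff// pnatr_eq0 -lt0n.
Qed.

Lemma sum2_expR_gt0 (f : chi -> chi -> R) : 0 < \sum_u \sum_v expR (f u v).
Proof.
apply: (sum1_gt0 (p := fun=> #|chi|%:R^-1)) => [|x]; last exact: sum_expR_gt0.
by rewrite sum_cst divff// pnatr_eq0 -lt0n.
Qed.

Lemma muV_gt0 l i x : 0 < muV l i x.
Proof. exact: divr_gt0 (expR_gt0 _) (sum_expR_gt0 _). Qed.

Lemma muV_sum l i : \sum_x muV l i x = 1.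
Proof. by rewrite -mulr_suml divff// gt_eqF// sum_expR_gt0. Qed.

Lemma muE_gt0 l e x y : 0 < muE l e x y.
Proof. exact: divr_gt0 (expR_gt0 _) (sum2_expR_gt0 _). Qed.

Lemma muE_sum l e : \sum_x \sum_y muE l e x y = 1.
Proof.
under eq_bigr do rewrite -mulr_suml.
by rewrite -mulr_suml divff// gt_eqF// sum2_expR_gt0.
Qed.

Lemma Smarg_gt0 l e b x : 0 < Smarg l e b x.
Proof.
rewrite /Smarg; case: b.
  by apply: (sum1_gt0 (muV_sum l (src e))) => y; exact: muE_gt0.
by apply: (sum1_gt0 (muV_sum l (src e))) => y; exact: muE_gt0.
Qed.

Lemma marg_sum F b : \sum_x marg F b x = \sum_x \sum_y F x y.
Proof. by case: b => //; exact: exchange_big. Qed.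

Lemma Smarg_sum l e b : \sum_x Smarg l e b x = 1.
Proof. by rewrite -(muE_sum l e) -(marg_sum _ b). Qed.

Lemma slack_sum l e b : \sum_x slack l e b x = 0.
Proof. by rewrite sumrB Smarg_sum muV_sum subrr. Qed.

(** [- eta] times the Lagrangian of the linear program at multipliers [l]. Adding the entropies of
    [mv] and [me] and maximizing over normalized tables gives [pot l]. *)
Definition expoM (mv : V -> chi -> R) (me : E -> chi -> chi -> R) (l : lam) : R :=
  \sum_i \sum_x mv i x * expoV l i x + \sum_e \sum_x \sum_y me e x y * expoE l e x y.

(** Each multiplier enters the logit of its vertex with a plus sign and that of its edge with a
    minus sign. *)
Lemma expoME mv me l : expoM mv me l = - eta * cost mv me
  - eta * \sum_p \sum_x
      l p.1 p.2 x * (marg (me p.1) p.2 x - mv (endp p.1 p.2) x).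
Proof.
have vE : \sum_i \sum_x mv i x * expoV l i x = - eta * (\sum_i \sum_x Ci i x * mv i x)
    + eta * \sum_p \sum_x l p.1 p.2 x * mv (endp p.1 p.2) x.
  rewrite sum_blocks_at !mulr_sumr -big_split; apply: eq_bigr => i _ /=.
  rewrite exchange_big/= !mulr_sumr -big_split; apply: eq_bigr => x _ /=.
  rewrite (eq_bigr (fun p => l p.1 p.2 x * mv i x)); last by move=> p /eqP ->.
  by rewrite -mulr_suml /expoV; ring.
have eE : \sum_e \sum_x \sum_y me e x y * expoE l e x y =
    - eta * (\sum_e \sum_x \sum_y Ce e x y * me e x y)
    - eta * \sum_p \sum_x l p.1 p.2 x * marg (me p.1) p.2 x.
  rewrite sum_blocks !mulr_sumr -sumrB; apply: eq_bigr => e _ /=.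
  rewrite big_bool/= /marg.
  under [X in _ * (X + _)]eq_bigr do rewrite mulr_sumr.
  rewrite [X in _ * (X + _)]exchange_big -[X in _ - _ * X]big_split/= !mulr_sumr -sumrB.
  apply: eq_bigr => x _; rewrite [l e false x * _]mulr_sumr.
  rewrite -[X in _ - _ * X]big_split/= !mulr_sumr -sumrB.
  by apply: eq_bigr => y _; rewrite /expoE; ring.
rewrite /expoM vE eE /cost.
have -> : \sum_p \sum_x l p.1 p.2 x * (marg (me p.1) p.2 x - mv (endp p.1 p.2) x) =
    \sum_p \sum_x l p.1 p.2 x * marg (me p.1) p.2 x
    - \sum_p \sum_x l p.1 p.2 x * mv (endp p.1 p.2) x.
  rewrite -sumrB; apply: eq_bigr => p _; rewrite -sumrB.
  by apply: eq_bigr => x _; rewrite mulrBr.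
by ring.
Qed.

(** Gibbs' inequality at each vertex and edge. It covers competitors whose edge marginals differ
    from [mv]. *)
Lemma expoM_le_pot mv me l :
  (forall i x, 0 <= mv i x) -> (forall i, \sum_x mv i x = 1) ->
  (forall e x y, 0 <= me e x y) -> (forall e, \sum_x \sum_y me e x y = 1) ->
  expoM mv me l <= pot l.
Proof.
move=> mv0 mv1 me0 me1; apply: lerD; apply: ler_sum.
  move=> i _; have := gibbs_ge (mv0 i) (mv1 i) (fun x => expR_gt0 (expoV l i x)).
  by under eq_bigr do rewrite expRK.
move=> e _; rewrite !pair_bigA/=.
have := gibbs_ge (T := (chi * chi)%type) (p := fun q => me e q.1 q.2)
  (w := fun q => expR (expoE l e q.1 q.2)) (fun q => me0 e q.1 q.2) _
  (fun q => expR_gt0 _).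
rewrite -{1}(pair_bigA _ (me e)) => /(_ (me1 e)).
by move=> /=; under eq_bigr do rewrite expRK.
Qed.

(** The entropy is at most [ln #|chi|] per vertex and twice that per edge, whose table has
    [#|chi| ^ 2] entries. *)
Lemma pot_le_expoM l :
  pot l <= expoM (muV l) (muE l) l + (#|V|%:R + 2 * #|E|%:R) * ln #|chi|%:R.
Proof.
rewrite mulrDl [2 * _]mulrC -mulrA -2!sum_cst /expoM addrACA -!big_split /pot.
apply: lerD; apply: ler_sum.
  move=> i _; have := gibbs_softmax chi_gt0 (fun x => expR_gt0 (expoV l i x)).
  by under [X in _ <= X + _]eq_bigr do rewrite expRK.
move=> e _; rewrite !pair_bigA/=.
have := gibbs_softmax (T := (chi * chi)%type)
  (w := fun q => expR (expoE l e q.1 q.2)) _ (fun q => expR_gt0 _).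
rewrite card_prod muln_gt0 chi_gt0 natrM lnM ?posrE ?ltr0n// => /(_ isT)/=.
under [X in _ <= X + _]eq_bigr do rewrite expRK.
by rewrite -[ln _ + ln _]mulr2n mulr_natl /muE pair_bigA.
Qed.

Lemma Cinf_ge0 : 0 <= Cinf.
Proof. by rewrite le_max; apply/orP; left; exact: bigmax_ge_id. Qed.

Lemma Ci_le i x : `|Ci i x| <= Cinf.
Proof.
rewrite le_max; apply/orP; left.
exact: (le_bigmax 0 (fun p : V * chi => `|Ci p.1 p.2|) (i, x)).
Qed.

Lemma Ce_le e x y : `|Ce e x y| <= Cinf.
Proof.
rewrite le_max; apply/orP; right.
exact: (le_bigmax 0 (fun p : E * chi * chi => `|Ce p.1.1 p.1.2 p.2|) (e, x, y)).
Qed.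

Lemma sum_muleR_le (T : finType) (c f : T -> R) C :
  (forall x, `|c x| <= C) -> `|\sum_x c x * f x| <= C * \sum_x `|f x|.
Proof.
move=> cC; apply: le_trans (ler_norm_sum _ _ _) _; rewrite mulr_sumr.
by apply: ler_sum => x _; rewrite normrM ler_wpM2r.
Qed.

Lemma cost_le mv me :
  `|cost mv me| <= Cinf * (\sum_i \sum_x `|mv i x| + \sum_e \sum_x \sum_y `|me e x y|).
Proof.
apply: le_trans (ler_normD _ _) _; rewrite mulrDr; apply: lerD.
  apply: le_trans (ler_norm_sum _ _ _) _; rewrite mulr_sumr; apply: ler_sum => i _.
  exact: sum_muleR_le (Ci_le i).
apply: le_trans (ler_norm_sum _ _ _) _; rewrite mulr_sumr; apply: ler_sum => e _.
rewrite !pair_bigA.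
exact: (sum_muleR_le (c := fun q : chi * chi => Ce e q.1 q.2)
  _ (fun q => Ce_le e q.1 q.2)).
Qed.

(** Mass 1 serves genuine distributions, mass [t] the perturbation that builds the competitor. *)
Lemma cost_mass_le mv me t :
  (forall i x, 0 <= mv i x) -> (forall i, \sum_x mv i x = t) ->
  (forall e x y, 0 <= me e x y) -> (forall e, \sum_x \sum_y me e x y = t) ->
  `|cost mv me| <= Cinf * ((#|E|%:R + #|V|%:R) * t).
Proof.
move=> mv0 mvt me0 met; apply: le_trans (cost_le mv me) _.
rewrite ler_wpM2l ?Cinf_ge0// addrC mulrDl lerD//.
  rewrite (eq_bigr (fun=> t)) ?sum_cst// => e _; rewrite -(met e).
  by apply: eq_bigr => x _; apply: eq_bigr => y _; rewrite ger0_norm.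
rewrite (eq_bigr (fun=> t)) ?sum_cst// => i _; rewrite -(mvt i).
by apply: eq_bigr => x _; rewrite ger0_norm.
Qed.

(** Only the log-partition functions at [i] and its edges move, each by the log of the mean
    exponential increment under the current Gibbs distribution. Without loops an edge changes on one
    side only, so its other index sums out into [Smarg]. *)
Lemma pot_local_update (l l' : lam) i :
  (forall e b x, endp e b != i -> l' e b x = l e b x) ->
  let dl (p : E * bool) x := l' p.1 p.2 x - l p.1 p.2 x in
  pot l' = pot l
    + ln (\sum_x muV l i x * expR (eta * \sum_(p | endp p.1 p.2 == i) dl p x))
    + \sum_(p | endp p.1 p.2 == i)
        ln (\sum_x Smarg l p.1 p.2 x * expR (- (eta * dl p x))).
Proof.
move=> same dl.
have hV : \sum_j ln (\sum_z expR (expoV l' j z)) = \sum_j ln (\sum_z expR (expoV l j z))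
    + ln (\sum_x muV l i x * expR (eta * \sum_(p | endp p.1 p.2 == i) dl p x)).
  rewrite (bigD1 i)//= [in RHS](bigD1 i)//= addrAC; congr (_ + _); last first.
    apply: eq_bigr => j ji; congr ln; apply: eq_bigr => z _; congr (expR (_ + _ * _)).
    by apply: eq_bigr => p /eqP pj; rewrite same// pj.
  rewrite -lnM ?posrE ?sum_expR_gt0//; last first.
    by apply: (sum1_gt0 (muV_sum l i)) => x; rewrite mulr_gt0 ?muV_gt0 ?expR_gt0.
  congr ln; rewrite mulr_sumr; apply: eq_bigr => x _.
  rewrite mulrA /muV mulrCA divff ?gt_eqF ?sum_expR_gt0// mulr1 -exp.expRD.
  by congr expR; rewrite /expoV sumrB; ring.
have hE : \sum_e ln (\sum_u \sum_v expR (expoE l' e u v)) =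
    \sum_e ln (\sum_u \sum_v expR (expoE l e u v)) +
    \sum_(p | endp p.1 p.2 == i)
        ln (\sum_x Smarg l p.1 p.2 x * expR (- (eta * dl p x))).
  rewrite sum_blocks -big_split; apply: eq_bigr => e _ /=.
  pose X := \sum_x \sum_y muE l e x y
    * expR (- (eta * dl (e, false) x) - eta * dl (e, true) y).
  have X0 : 0 < X.
    apply: (sum1_gt0 (muV_sum l i)) => x; apply: (sum1_gt0 (muV_sum l i)) => y.
    by rewrite mulr_gt0 ?muE_gt0 ?expR_gt0.
  transitivity (ln (\sum_u \sum_v expR (expoE l e u v)) + ln X).
    rewrite -lnM ?posrE ?sum2_expR_gt0//; congr ln; rewrite mulr_sumr.
    apply: eq_bigr => x _; rewrite mulr_sumr; apply: eq_bigr => y _.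
    rewrite mulrA /muE mulrCA divff ?gt_eqF ?sum2_expR_gt0// mulr1 -exp.expRD.
    by congr expR; rewrite /expoE /dl; ring.
  congr (_ + _); rewrite big_mkcond big_bool/= /X.
  have := no_loop e.
  have dl0 b x : endp e b != i -> dl (e, b) x = 0 by move=> ?; rewrite /dl same// subrr.
  case: (eqVneq (src e) i) => [-> ti|si _].
    rewrite eq_sym (negPf ti) add0r; congr ln; apply: eq_bigr => x _.
    rewrite mulr_suml; apply: eq_bigr => y _.
    by rewrite (dl0 true) 1?eq_sym// mulr0 subr0.
  case: (eqVneq (tgt e) i) => [ti|ti].
    rewrite addr0 exchange_big; congr ln; apply: eq_bigr => x _.
    rewrite mulr_suml; apply: eq_bigr => y _.
    by rewrite (dl0 false)// mulr0 oppr0 add0r.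
  rewrite addr0 -[RHS]ln1 -[X in _ = ln X](muE_sum l e); congr ln.
  apply: eq_bigr => x _; apply: eq_bigr => y _.
  by rewrite (dl0 false)// (dl0 true)// mulr0 oppr0 addr0 exp.expR0 mulr1.
by rewrite /pot hV hE; ring.
Qed.

Hypothesis eta_neq0 : eta != 0.

(** Moving by half the log-ratio reweights both [muV] and [Smarg] to their unnormalized geometric
    mean, so [pot] changes by exactly [2 * ln H]. *)
Lemma emp_descent (l : lam) (blk : E * bool) :
  pot (emp_update src tgt Ci Ce eta blk l)
    + (\sum_x `|slack l blk.1 blk.2 x|) ^+ 2 / 4 <= pot l.
Proof.
case: blk => e b /=; set l' := emp_update _ _ _ _ _ _ _; set i := endp e b.
have same e' b' x : (e', b') != (e, b) -> l' e' b' x = l e' b' x.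
  by rewrite /l' /emp_update => /negPf ->.
have dE x : eta * (l' e b x - l e b x) =
    (ln (Smarg l e b x) - ln (muV l i x)) / 2.
  rewrite /l' /emp_update eqxx ln_div ?posrE ?Smarg_gt0 ?muV_gt0// /i.
  by field.
rewrite (@pot_local_update l l' i); last first.
  by move=> e' b' x h; apply: same; apply: contra h => /eqP [-> ->].
have hell := hellinger (muV_gt0 l i) (muV_sum l i) (Smarg_gt0 l e b) (Smarg_sum l e b).
set H := \sum_x expR _ in hell.
have -> : \sum_x `|slack l e b x| = \sum_x `|muV l i x - Smarg l e b x|.
  by apply: eq_bigr => x _; rewrite distrC.
rewrite (_ : \sum_x muV l i x * _ = H); last first.
  apply: eq_bigr => x _; rewrite (bigD1 (e, b))//= big1 ?addr0; last first.
    by move=> [e' b'] /andP[_ h]; rewrite same// subrr.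
  rewrite dE -[X in X * _](@lnK R) ?posrE ?muV_gt0// -exp.expRD; congr expR.
  by field.
rewrite (bigD1 (e, b))//= [X in _ + (_ + X)]big1 ?addr0; last first.
  move=> [e' b'] /andP[_ h]; rewrite -[RHS]ln1 -[X in _ = ln X](Smarg_sum l e' b'); congr ln.
  by apply: eq_bigr => x _; rewrite same//= subrr mulr0 oppr0 exp.expR0 mulr1.
rewrite (_ : \sum_x Smarg l e b x * _ = H); first by lra.
apply: eq_bigr => x _.
rewrite dE -[X in X * _](@lnK R) ?posrE ?Smarg_gt0// -exp.expRD; congr expR.
by field.
Qed.

(** The step reweights the vertex marginal and all [N] edge marginals at [i] to one geometric mean,
    of mass [G], so [pot] changes by [(N + 1) * ln G]; [ln_sum_geo_mean_le] compares this with the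
    EMP step at [p]. *)
Lemma smp_descent (l : lam) i (p : E * bool) : endp p.1 p.2 == i ->
  pot (smp_update src tgt Ci Ce eta i l)
    + (\sum_x `|slack l p.1 p.2 x|) ^+ 2 / 4 <= pot l.
Proof.
move=> pi; set l' := smp_update _ _ _ _ _ _ _.
pose N : R := (nbr src tgt i)%:R.
have N1 : N + 1 != 0 by rewrite gt_eqF// ltr_wpDl// ler0n.
pose A x := ln (muV l i x) + \sum_(p | endp p.1 p.2 == i) ln (Smarg l p.1 p.2 x).
have AE x : ln (muV l i x * \prod_(p | endp p.1 p.2 == i) Smarg l p.1 p.2 x) = A x.
  rewrite -[RHS]expRK exp.expRD expR_sum lnK ?posrE ?muV_gt0//; congr (ln (_ * _)).
  by apply: eq_bigr => q _; rewrite lnK// posrE Smarg_gt0.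
have dE q x : endp q.1 q.2 == i ->
    eta * (l' q.1 q.2 x - l q.1 q.2 x) = ln (Smarg l q.1 q.2 x) - A x / (N + 1).
  move=> qi; rewrite /l' /smp_update qi AE -/N; field.
  by rewrite N1 eta_neq0.
rewrite (@pot_local_update l l' i); last first.
  by move=> e b x h; rewrite /l' /smp_update (negPf h).
set G := \sum_x expR (A x / (N + 1)).
have NE : N = \sum_(q | endp q.1 q.2 == i) 1 by exact: nbrE.
rewrite (_ : \sum_x muV l i x * _ = G); last first.
  apply: eq_bigr => x _; rewrite mulr_sumr.
  rewrite (eq_bigr (fun q => ln (Smarg l q.1 q.2 x) - A x / (N + 1))) => [|q]; last first.
    exact: dE.
  rewrite -[X in X * _](@lnK R) ?posrE ?muV_gt0// -exp.expRD; congr expR.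
  rewrite sumrB addrA -/(A x).
  have -> : \sum_(q | endp q.1 q.2 == i) A x / (N + 1) = N * (A x / (N + 1)).
    by rewrite {2}NE mulr_suml; apply: eq_bigr => q _; rewrite mul1r.
  by field.
rewrite (eq_bigr (fun=> 1 * ln G)) => [|q qi]; last first.
  rewrite mul1r; congr ln; apply: eq_bigr => x _; rewrite dE//.
  rewrite -[X in X * _](@lnK R) ?posrE ?Smarg_gt0// -exp.expRD; congr expR; ring.
rewrite -mulr_suml -NE.
have := ln_sum_geo_mean_le (S := fun (q : E * bool) => Smarg l q.1 q.2) pi NE
  (muV_gt0 l i) (muV_sum l i) (fun q => Smarg_gt0 l q.1 q.2)
  (fun q => Smarg_sum l q.1 q.2).
have := hellinger (muV_gt0 l i) (muV_sum l i) (Smarg_gt0 l p.1 p.2) (Smarg_sum l p.1 p.2).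
have -> : \sum_x `|slack l p.1 p.2 x| = \sum_x `|muV l i x - Smarg l p.1 p.2 x|.
  by apply: eq_bigr => x _; rewrite distrC /slack (eqP pi).
rewrite -/G; lra.
Qed.

End Dual.

(** * Rounding *)

Section Rounding.
Variables (R : realType) (chi : finType) (F : chi -> chi -> R) (r c : chi -> R).
Hypotheses (F0 : forall x y, 0 <= F x y) (F1 : \sum_x \sum_y F x y = 1).
Hypotheses (r0 : forall x, 0 <= r x) (r1 : \sum_x r x = 1).
Hypotheses (c0 : forall x, 0 <= c x) (c1 : \sum_x c x = 1).

(* Holds for [f = 0] too, thanks to [u / 0 = 0]. *)
Lemma min_div_mul (u f : R) : 0 <= u -> 0 <= f ->
  Num.min (u / f) 1 * f = Num.min u f.
Proof.
move=> u0; rewrite le_eqVlt => /orP[/eqP <-|f0].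
  by rewrite mulr0 min_r.
by rewrite minr_pMl ?ltW// mul1r mulfVK// gt_eqF.
Qed.

(** Scaling only lowers entries, so [er] and [ec] are nonnegative and each totals the mass removed.
    That mass is at most the row excess plus the column excess; removing it and putting it back
    gives the factor 2. *)
Lemma round_correct :
  [/\ forall x y, 0 <= Defs.round F r c x y,
      forall x, \sum_y Defs.round F r c x y = r x,
      forall y, \sum_x Defs.round F r c x y = c y
    & \sum_x \sum_y `|Defs.round F r c x y - F x y|
        <= 2 * (\sum_x `|\sum_y F x y - r x| + \sum_y `|\sum_x F x y - c y|)].
Proof.
pose a x := Num.min (r x / \sum_y F x y) 1.
pose G x y := a x * F x y.
pose b y := Num.min (c y / \sum_x G x y) 1.
pose H x y := G x y * b y.
pose er x := r x - \sum_y H x y.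
pose ec y := c y - \sum_x H x y.
have rF0 x : 0 <= \sum_y F x y by apply: sumr_ge0.
have a0 x : 0 <= a x by rewrite le_min ler01 divr_ge0.
have a1 x : a x <= 1 by rewrite ge_min lexx orbT.
have G0 x y : 0 <= G x y by rewrite mulr_ge0.
have GF x y : G x y <= F x y by rewrite ler_piMl.
have cG0 y : 0 <= \sum_x G x y by apply: sumr_ge0.
have b0 y : 0 <= b y by rewrite le_min ler01 divr_ge0.
have b1 y : b y <= 1 by rewrite ge_min lexx orbT.
have H0 x y : 0 <= H x y by rewrite mulr_ge0.
have HG x y : H x y <= G x y by rewrite ler_piMr.
have HF x y : H x y <= F x y by exact: le_trans (HG x y) (GF x y).
have rG x : \sum_y G x y = Num.min (r x) (\sum_y F x y).
  by rewrite -mulr_sumr min_div_mul.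
have cH y : \sum_x H x y = Num.min (c y) (\sum_x G x y).
  by rewrite -mulr_suml mulrC min_div_mul.
have er0 x : 0 <= er x.
  rewrite subr_ge0; apply: (@le_trans _ _ (\sum_y G x y)); first exact: ler_sum.
  by rewrite rG ge_min lexx.
have ec0 y : 0 <= ec y by rewrite subr_ge0 cH ge_min lexx.
have ser : \sum_x er x = 1 - \sum_x \sum_y H x y by rewrite sumrB r1.
have sec : \sum_y ec y = 1 - \sum_x \sum_y H x y by rewrite sumrB c1 exchange_big.
have massFG : 1 - \sum_x \sum_y G x y <= \sum_x `|\sum_y F x y - r x|.
  rewrite -F1 -sumrB; apply: ler_sum => x _; rewrite rG.
  by case: (leP (r x)) => _; [exact: ler_norm|rewrite subrr].
have massGH : \sum_x \sum_y G x y - \sum_x \sum_y H x y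
    <= \sum_y `|\sum_x F x y - c y|.
  rewrite exchange_big [X in _ - X]exchange_big -sumrB; apply: ler_sum => y _ /=.
  rewrite cH; case: (leP (c y)) => _; last by rewrite subrr.
  (* [G] lies below [F], so its column excess over [c] is no larger. *)
  by apply: le_trans (ler_norm _); rewrite lerD2r; apply: ler_sum.
have sFH : \sum_x \sum_y `|H x y - F x y| = \sum_y ec y.
  rewrite sec -F1 -sumrB; apply: eq_bigr => x _; rewrite -sumrB.
  by apply: eq_bigr => y _; rewrite distrC ger0_norm// subr_ge0.
have roundE : Defs.round F r c = if [forall y, ec y == 0] then H
  else fun x y => H x y + er x * ec y / \sum_z `|ec z| by [].
rewrite roundE; case: ifPn => [/forallP ecz|ecnz].
  have s0 : \sum_y ec y = 0 by apply: big1 => y _; exact/eqP.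
  (* The totals agree, so a vanishing [ec] forces the nonnegative [er] to vanish. *)
  have erz x : er x = 0.
    have : \sum_x er x = 0 by rewrite ser -sec.
    by move/(psumr_eq0P (fun x _ => er0 x)); apply.
  split=> // [x|y|]; first by apply/esym/eqP; rewrite -subr_eq0; apply/eqP/erz.
    by apply/esym/eqP; rewrite -subr_eq0; exact: ecz.
  by rewrite sFH s0 mulr_ge0// addr_ge0// sumr_ge0.
have nE : \sum_z `|ec z| = \sum_z ec z by apply: eq_bigr => z _; rewrite ger0_norm.
have n0 : 0 < \sum_z ec z.
  move: ecnz; rewrite negb_forall => /existsP[z ez].
  rewrite (bigD1 z)//= ltr_pwDl ?sumr_ge0// lt_neqAle ec0 andbT eq_sym//.
rewrite nE.
have rowE x : \sum_y er x * ec y / (\sum_z ec z) = er x.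
  by rewrite -mulr_suml -mulr_sumr mulfK// gt_eqF.
have colE y : \sum_x er x * ec y / (\sum_z ec z) = ec y.
  rewrite -mulr_suml -mulr_suml ser -sec mulrAC divff ?mul1r// gt_eqF//.
split=> [x y|x|y|].
- by rewrite addr_ge0// divr_ge0 ?mulr_ge0// ltW.
- by rewrite big_split/= rowE subrKC.
- by rewrite big_split/= colE subrKC.
apply: (@le_trans _ _ (\sum_x \sum_y (`|H x y - F x y| + er x * ec y / \sum_z ec z))).
  apply: ler_sum => x _; apply: ler_sum => y _; rewrite addrAC.
  apply: le_trans (ler_normD _ _) _.
  by rewrite lerD2l [X in X <= _]ger0_norm// divr_ge0 ?mulr_ge0// ltW.
under eq_bigr do rewrite big_split/= rowE.
rewrite big_split/= sFH ser -sec; lra.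
Qed.

End Rounding.

(** * Primal gap and expected decrease *)

Section Guarantee.
Variables (R : realType) (V E chi : finType) (src tgt : E -> V).
Variables (Ci : V -> chi -> R) (Ce : E -> chi -> chi -> R) (eta : R).
Hypothesis no_loop : forall e, src e != tgt e.
Hypothesis chi_gt0 : (0 < #|chi|)%N.

Local Notation lam := (lam R E chi).
Local Notation endp := (endp src tgt).
Local Notation muV := (muV src tgt Ci eta).
Local Notation muE := (muE Ce eta).
Local Notation slack := (slack src tgt Ci Ce eta).
Local Notation cost := (cost Ci Ce).
Local Notation Cinf := (Cinf Ci Ce).
Local Notation objective := (objective src tgt Ci Ce eta).
Local Notation projV := (projV src tgt Ci eta).
Local Notation projE := (projE src tgt Ci Ce eta).
Local Notation inL2 := (@inL2 R V E chi src tgt).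
Local Notation pot := (pot src tgt Ci Ce eta).
Local Notation expoM := (expoM src tgt Ci Ce eta).
Local Notation m := (@GRing.natmul R 1 #|E|).
Local Notation n := (@GRing.natmul R 1 #|V|).
Local Notation d := (@GRing.natmul R 1 #|chi|).

(** This shape covers the mixture in the competitor and, with [a = -1], the difference between a
    projection and [mu]. *)
Lemma cost_lin a mv me mv' me' :
  cost (fun i x => a * mv i x + mv' i x) (fun e x y => a * me e x y + me' e x y)
  = a * cost mv me + cost mv' me'.
Proof.
rewrite /cost mulrDr addrACA !mulr_sumr -!big_split; congr (_ + _).
  apply: eq_bigr => i _; rewrite mulr_sumr -big_split.
  by apply: eq_bigr => x _ /=; ring.
apply: eq_bigr => e _; rewrite mulr_sumr -big_split; apply: eq_bigr => x _ /=.
by rewrite mulr_sumr -big_split; apply: eq_bigr => y _ /=; ring.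
Qed.

Lemma inL2_mass mv me : inL2 mv me -> forall e, \sum_x \sum_y me e x y = 1.
Proof. by case=> _ _ mv1 row _ e; under eq_bigr do rewrite row. Qed.

Lemma inL2_cost_le mv me : inL2 mv me -> `|cost mv me| <= Cinf * (m + n).
Proof.
move=> h; have := inL2_mass h; case: h => mv0 me0 mv1 _ _ me1.
by rewrite -[m + n]mulr1; exact: cost_mass_le.
Qed.

Lemma mu_cost_le l : `|cost (muV l) (muE l)| <= Cinf * (m + n).
Proof.
rewrite -[m + n]mulr1; apply: cost_mass_le => *.
- exact: ltW (muV_gt0 _ _ _ _ _ _ _ _).
- exact: muV_sum.
- exact: ltW (muE_gt0 _ _ _ _ _ _ _).
- exact: muE_sum.
Qed.

Lemma proj_round l e :
  [/\ forall x y, 0 <= projE l e x y,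
      forall x, \sum_y projE l e x y = muV l (src e) x,
      forall y, \sum_x projE l e x y = muV l (tgt e) y
    & \sum_x \sum_y `|projE l e x y - muE l e x y|
        <= 2 * (\sum_x `|slack l e false x| + \sum_x `|slack l e true x|)].
Proof.
apply: round_correct => *.
- exact: ltW (muE_gt0 _ _ _ _ _ _ _).
- exact: muE_sum.
- exact: ltW (muV_gt0 _ _ _ _ _ _ _ _).
- exact: muV_sum.
- exact: ltW (muV_gt0 _ _ _ _ _ _ _ _).
- exact: muV_sum.
Qed.

Lemma proj_inL2 l : inL2 (projV l) (projE l).
Proof.
split=> [i x|e x y|i|e x|e y].
- exact: ltW (muV_gt0 _ _ _ _ _ _ _ _).
- by have [] := proj_round l e.
- exact: muV_sum.
- by have [] := proj_round l e.
- by have [] := proj_round l e.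
Qed.

Lemma objective_ge0 l : 0 <= objective l.
Proof. by apply: sumr_ge0 => p _; exact: sqr_ge0. Qed.

Lemma slack_le_sqrt_objective l e b :
  \sum_x `|slack l e b x| <= Num.sqrt (objective l).
Proof.
rewrite -(ler_pXn2r (n := 2))// ?nnegrE ?sqrtr_ge0 ?sumr_ge0//.
rewrite sqr_sqrtr ?objective_ge0// /objective (bigD1 (e, b))//= lerDl.
by apply: sumr_ge0 => p _; exact: sqr_ge0.
Qed.

Hypothesis eta_gt0 : 0 < eta.

(* The competitor must have the same slack as [mu l] for the multipliers to
   cancel: mix the given point with the uniform one, with a weight just large
   enough to absorb the slack. *)
Lemma mu_cost_competitor l mv me s :
  (forall e b x, `|slack l e b x| <= s) -> inL2 mv me -> 0 <= s ->
  cost (muV l) (muE l) <= cost mv me + (n + 2 * m) * ln d / eta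
    + 4 * (m + n) * d * s * Cinf.
Proof.
move=> nus h s0; have me1 := inL2_mass h; have cle := inL2_cost_le h.
have C0 := Cinf_ge0 Ci Ce.
have d1 : 1 <= d by rewrite ler1n.
have dn0 : d != 0 by rewrite gt_eqF// (lt_le_trans ltr01).
have ent0 : 0 <= (n + 2 * m) * ln d / eta.
  apply: divr_ge0; last exact: ltW.
  by rewrite mulr_ge0 ?ln_ge0// addr_ge0 ?mulr_ge0 ?ler0n.
have mn0 : 0 <= Cinf * (m + n) by rewrite mulr_ge0// addr_ge0 ?ler0n.
pose t := 2 * d * s.
have t0 : 0 <= t by rewrite !mulr_ge0// ler0n.
have -> : 4 * (m + n) * d * s * Cinf = 2 * t * (Cinf * (m + n)) by rewrite /t; ring.
(* For [t > 1] the error term is at least [2 * (Cinf * (m + n))], which bounds any difference of the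
   two costs. *)
have [t1|/ltW t1] := leP t 1; last first.
  have := mu_cost_le l; rewrite ler_norml => /andP[_ h1].
  by move: cle; rewrite ler_norml => /andP[h2 _]; nra.
(* [t] times the uniform point, plus each slack spread evenly over the opposite index. A slack sums
   to zero, so it alters only its own marginal; [2 * s] outweighs two slacks of size [s]. *)
pose rV (i : V) (x : chi) := 2 * s.
pose rE e x y := 2 * s / d + (slack l e false x + slack l e true y) / d.
pose kV i x := (1 - t) * mv i x + rV i x.
pose kE e x y := (1 - t) * me e x y + rE e x y.
case: (h) => mv0 me0 mv1 row col.
have rV0 i x : 0 <= rV i x by rewrite mulr_ge0.
have rE0 e x y : 0 <= rE e x y.
  rewrite /rE -mulrDl divr_ge0 ?ler0n//.
  have := nus e false x; have := nus e true y.
  by rewrite !ler_norml => /andP[h1 _] /andP[h2 _]; lra.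
have rErow e x : \sum_y rE e x y = 2 * s + slack l e false x.
  rewrite /rE big_split/= sum_cst -mulr_suml big_split/= sum_cst slack_sum//.
  by field.
have rEcol e y : \sum_x rE e x y = 2 * s + slack l e true y.
  rewrite /rE big_split/= sum_cst -mulr_suml big_split/= sum_cst slack_sum//.
  by field.
have rVt i : \sum_x rV i x = t by rewrite /rV sum_cst /t; ring.
have rEt e : \sum_x \sum_y rE e x y = t.
  under eq_bigr do rewrite rErow.
  by rewrite big_split/= slack_sum// sum_cst /t; ring.
have t1' : 0 <= 1 - t by rewrite subr_ge0.
have kV0 i x : 0 <= kV i x by rewrite addr_ge0 ?mulr_ge0.
have kE0 e x y : 0 <= kE e x y by rewrite addr_ge0 ?mulr_ge0.
have kV1 i : \sum_x kV i x = 1 by rewrite big_split/= -mulr_sumr mv1 rVt; ring.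
have kE1 e : \sum_x \sum_y kE e x y = 1.
  under eq_bigr do rewrite big_split/= -mulr_sumr.
  by rewrite big_split/= -mulr_sumr me1 rEt; ring.
have slackE e b x : marg (kE e) b x - kV (endp e b) x = slack l e b x.
  rewrite /marg /kV /rV; case: b; rewrite big_split/= -mulr_sumr.
    by rewrite col rEcol; ring.
  by rewrite row rErow; ring.
have := le_trans (expoM_le_pot src tgt Ci Ce eta l kV0 kV1 kE0 kE1)
  (pot_le_expoM src tgt Ci Ce eta chi_gt0 l).
rewrite !expoME.
have -> : \sum_p \sum_x l p.1 p.2 x * (marg (kE p.1) p.2 x - kV (endp p.1 p.2) x) =
  \sum_p \sum_x l p.1 p.2 x * (marg (muE l p.1) p.2 x - muV l (endp p.1 p.2) x).
  by apply: eq_bigr => p _; apply: eq_bigr => x _; rewrite slackE.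
set z := \sum_p _ => hz.
have hcost : cost (muV l) (muE l) <= cost kV kE + (n + 2 * m) * ln d / eta.
  rewrite -subr_ge0 -(pmulr_rge0 _ eta_gt0).
  have -> : eta * (cost kV kE + (n + 2 * m) * ln d / eta - cost (muV l) (muE l)) =
    eta * cost kV kE + (n + 2 * m) * ln d - eta * cost (muV l) (muE l).
    by field; rewrite gt_eqF.
  lra.
have rle : cost rV rE <= Cinf * ((m + n) * t).
  by apply: le_trans (ler_norm _) _; exact: cost_mass_le.
apply: le_trans hcost _; rewrite /kV /kE cost_lin.
move: cle; rewrite ler_norml => /andP[h2 _].
(* Scaling the given point down costs at most [t * (Cinf * (m + n))], and adding [rV], [rE] as much
   again. *)
have : t * - (Cinf * (m + n)) <= t * cost mv me by rewrite ler_wpM2l.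
rewrite mulrA in rle; lra.
Qed.

(** Rounding keeps the vertex marginals and moves each edge table by at most [4 * s]; as [d >= 1],
    doubling the constant 4 of the competitor bound absorbs this. *)
Lemma proj_cost_competitor l mv me : inL2 mv me ->
  cost (projV l) (projE l) <= cost mv me + (n + 2 * m) * ln d / eta
    + 8 * (m + n) * d * Num.sqrt (objective l) * Cinf.
Proof.
move=> h; set s := Num.sqrt _.
have s0 : 0 <= s by exact: sqrtr_ge0.
have slacks e b : \sum_x `|slack l e b x| <= s by exact: slack_le_sqrt_objective.
have C0 := Cinf_ge0 Ci Ce.
have d1 : 1 <= d by rewrite ler1n.
have comp : cost (muV l) (muE l) <= _ := @mu_cost_competitor l mv me s _ h s0.
have {comp} comp := comp (fun e b x => le_trans _ (slacks e b)).
have le1 e b x : `|slack l e b x| <= \sum_x `|slack l e b x|.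
  by rewrite (bigD1 x)//= lerDl sumr_ge0.
have {comp le1} comp := comp le1.
have dist : cost (projV l) (projE l) - cost (muV l) (muE l) <= Cinf * (m * (4 * s)).
  have -> : cost (projV l) (projE l) - cost (muV l) (muE l) =
    cost (fun i x => -1 * muV l i x + projV l i x)
         (fun e x y => -1 * muE l e x y + projE l e x y).
    by rewrite cost_lin; ring.
  apply: le_trans (ler_norm _) _; apply: le_trans (cost_le _ _ _ _) _.
  rewrite ler_wpM2l// big1 ?add0r; last first.
    by move=> i _; apply: big1 => x _; rewrite mulN1r addNr normr0.
  have -> : m * (4 * s) = \sum_(e : E) 4 * s by rewrite sum_cst.
  apply: ler_sum => e _; have [_ _ _] := proj_round l e.
  under eq_bigr do under eq_bigr do rewrite addrC -mulN1r.
  move/le_trans; apply; have := slacks e false; have := slacks e true; lra.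
have : m * (4 * s) <= 4 * (m + n) * d * s.
  have : 0 <= m by rewrite ler0n.
  have : 0 <= n by rewrite ler0n.
  move=> n0 m0; rewrite mulrCA -!mulrA ler_wpM2l// mulrA ler_wpM2r//.
  by apply: (@le_trans _ _ (m + n)); [lra|rewrite ler_peMr// addr_ge0].
move/(ler_wpM2l C0); lra.
Qed.

(** The uniform point is consistent, so the multipliers drop out of [expoME] and the bound is
    independent of [l]. *)
Lemma pot_ge l : - (eta * (Cinf * (m + n))) <= pot l.
Proof.
have d0 : 0 < d by rewrite ltr0n.
pose uV (i : V) (x : chi) := d^-1.
pose uE (e : E) (x y : chi) := d^-1 * d^-1.
have row e x : \sum_y uE e x y = d^-1 by rewrite sum_cst mulrA divff ?mul1r ?gt_eqF//.
have uL2 : inL2 uV uE.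
  split=> [i x|e x y|i|e x|e y]; rewrite ?invr_ge0 ?mulr_ge0 ?invr_ge0 ?ltW//.
    by rewrite sum_cst divff// gt_eqF.
  exact: row.
have [uV0 uE0 uV1 _ _] := uL2.
apply: le_trans (expoM_le_pot src tgt Ci Ce eta l uV0 uV1 uE0
  (inL2_mass uL2)).
rewrite expoME big1 ?mulr0 ?subr0; last first.
  move=> p _; apply: big1 => x _.
  rewrite (_ : marg _ _ _ = d^-1) ?subrr ?mulr0//.
  by rewrite /marg; case: p.2; exact: (row p.1 x).
rewrite mulNr lerN2 ler_wpM2l ?(ltW eta_gt0)//.
exact: le_trans (ler_norm _) (inL2_cost_le uL2).
Qed.

Lemma pot0_le :
  pot (lam0 R (E := E) (chi := chi)) <= eta * (Cinf * (m + n)) + (n + 2 * m) * ln d.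
Proof.
apply: le_trans (pot_le_expoM _ _ _ _ _ chi_gt0 _) _; rewrite lerD2r expoME.
rewrite big1 ?mulr0 ?subr0; last by move=> p _; apply: big1 => x _; rewrite mul0r.
rewrite mulNr -mulrN ler_wpM2l ?(ltW eta_gt0)//.
by apply: le_trans (ler_norm _) _; rewrite normrN mu_cost_le.
Qed.

Lemma emp_drift : (0 < #|E|)%N -> forall l,
  \sum_blk (2 * m)^-1 * pot (emp_update src tgt Ci Ce eta blk l)
    + objective l / (8 * m) <= pot l.
Proof.
move=> E0 l; have m0 : 0 < m by rewrite ltr0n.
rewrite -mulr_sumr -(ler_pM2l (_ : 0 < 2 * m)) ?mulr_gt0//.
rewrite mulrDr mulrA divff ?gt_eqF ?mulr_gt0// mul1r.
have -> : 2 * m * (objective l / (8 * m)) = objective l / 4 by field; rewrite gt_eqF.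
have -> : 2 * m * pot l = \sum_(p : E * bool) pot l.
  by rewrite sum_cst card_prod card_bool natrM; ring.
rewrite /objective mulr_suml -big_split; apply: ler_sum => p _.
by apply: emp_descent => //; exact: lt0r_neq0.
Qed.

Lemma sum_nbr : \sum_i (nbr src tgt i)%:R = 2 * m.
Proof.
under eq_bigr do rewrite nbrE//.
by rewrite -sum_blocks_at sum_cst card_prod card_bool natrM mulr1 mulrC.
Qed.

(** Weights proportional to [nbr i] let the vertex step be counted once per block at [i], against
    the slack of that block. *)
Lemma smp_drift : (0 < #|E|)%N -> forall l,
  \sum_i (nbr src tgt i)%:R / (\sum_j (nbr src tgt j)%:R)
    * pot (smp_update src tgt Ci Ce eta i l)
    + objective l / (8 * m) <= pot l.
Proof.
move=> E0 l; have m0 : 0 < m by rewrite ltr0n.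
rewrite sum_nbr; under eq_bigr do rewrite mulrAC.
rewrite -mulr_suml -(ler_pM2l (_ : 0 < 2 * m)) ?mulr_gt0//.
rewrite mulrDr mulrCA divff ?gt_eqF ?mulr_gt0// mulr1.
have -> : 2 * m * (objective l / (8 * m)) = objective l / 4 by field; rewrite gt_eqF.
rewrite -sum_nbr /objective !mulr_suml.
rewrite [X in _ + X <= _](sum_blocks_at src tgt) -big_split; apply: ler_sum => i _ /=.
rewrite nbrE// !mulr_suml -big_split; apply: ler_sum => p pi; rewrite !mul1r.
by apply: smp_descent => //; exact: lt0r_neq0.
Qed.

End Guarantee.

(** * Convergence *)

Section Main.
Variables (R : realType) (V E chi : finType) (src tgt : E -> V).
Variables (Ci : V -> chi -> R) (Ce : E -> chi -> chi -> R) (eps : R).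
Hypothesis graph : graph_ok src tgt.
Hypothesis chi_gt1 : (1 < #|chi|)%N.
Hypothesis eps_gt0 : 0 < eps.

Local Notation m := (@GRing.natmul R 1 #|E|).
Local Notation n := (@GRing.natmul R 1 #|V|).
Local Notation d := (@GRing.natmul R 1 #|chi|).
Local Notation eta := (4 * (m + n) * ln d / eps).
Local Notation objective := (objective src tgt Ci Ce eta).
Local Notation pot := (pot src tgt Ci Ce eta).
Local Notation Cinf := (Cinf Ci Ce).

Let chi_gt0 : (0 < #|chi|)%N. Proof. exact: ltnW. Qed.

(** Both procedures enter only through their sampling weights and the drift. Without edges the
    weights sum to 0, hence the guard in [p_sum]. *)
Variables (B : finType) (upd : B -> lam R E chi -> lam R E chi) (p : B -> R).
Hypothesis p_ge0 : forall b, 0 <= p b.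
Hypothesis p_sum : (0 < #|E|)%N -> \sum_b p b = 1.
Hypothesis drift : 0 < eta -> (0 < #|E|)%N -> forall l,
  \sum_b p b * pot (upd b l) + objective l / (8 * m) <= pot l.

(* The constant is 4 * 8 ^+ 2 * 96; as the single literal 24576 it would be a
   unary natural number, too large to be computed with. *)
Lemma drift_guarantee K :
  8 ^+ 2 * 24 * 16 * m * d ^+ 2 * (m + n) ^+ 4 * Cinf ^+ 3 * eps ^- 3 * ln d <= K%:R ->
  mp_guarantee src tgt Ci Ce eta upd p K eps.
Proof.
move=> hK sel argmin; split=> [s|mv me h]; first exact: proj_inL2.
have cle := inL2_cost_le Ci Ce h.
pose hat (s : K.-tuple B) := traj upd s (sel s).
have ple l := inL2_cost_le Ci Ce (proj_inL2 src tgt Ci Ce eta chi_gt0 l).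
have C0 := Cinf_ge0 Ci Ce.
(* Without edges there are no vertices either, and all costs are 0. *)
have [E0|E_gt0] := posnP #|E|.
  have V0 : n = 0.
    apply/eqP; rewrite pnatr_eq0; apply/eqP/eq_card0 => v; apply/negP => _.
    have [_ _ /(_ v) [e _]] := graph.
    by have := fintype0 e E0.
  have zero (x : R) : `|x| <= Cinf * (m + n) -> x = 0.
    by rewrite E0 V0 mulr0n addr0 mulr0 normr_le0 => /eqP.
  rewrite (zero _ cle) add0r /expect big1 ?ltW// => s _.
  by rewrite (zero _ (ple _)) mulr0.
have p1 := p_sum E_gt0.
have m0 : 0 < m by rewrite ltr0n.
have n0 : 0 < n.
  have /card_gt0P[e _] := E_gt0.
  by rewrite ltr0n; apply/card_gt0P; exists (src e).
have d1 : 1 < d by rewrite ltr1n.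
have d0 : 0 < d by apply: lt_trans d1.
have lnd : 0 < ln d by rewrite ln_gt0.
have M0 : 0 < m + n by rewrite addr_gt0.
have eta0 : 0 < eta by rewrite divr_gt0// !mulr_gt0.
(* If [Cinf] is this small, any two points of the polytope differ in cost by at most [eps];
   otherwise the entropy term is dominated in [avg]. *)
have [small|large] := leP (2 * (Cinf * (m + n))) eps.
  rewrite -[X in _ <= X](expect_cst p1 K); apply: expect_le => // s.
  have := ple (hat s); rewrite ler_norml => /andP[_ h1].
  by move: cle; rewrite ler_norml => /andP[h2 _]; rewrite /hat in h1 *; lra.
have C_gt0 : 0 < Cinf.
  have : 0 < 2 * (Cinf * (m + n)) by apply: lt_trans large.
  by rewrite pmulr_rgt0// pmulr_lgt0.
set M := m + n in M0 eta0 large cle ple hK *.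
set eta := _ / eps in eta0 *.
have K0 : 0 < K%:R :> R.
  apply: lt_le_trans hK; rewrite !mulr_gt0 ?exprn_gt0 ?invr_gt0 ?exprn_gt0//.
pose X := 8 * M * d * Cinf.
have ent : (n + 2 * m) * ln d <= eta * (eps / 2).
  have -> : eta * (eps / 2) = 2 * M * ln d by rewrite /eta; field; rewrite gt_eqF.
  by rewrite ler_wpM2r ?ltW// /M; lra.
have pointwise s : cost Ci Ce (projV src tgt Ci eta (hat s)) (projE src tgt Ci Ce eta (hat s))
    <= (cost Ci Ce mv me + eps / 2 + eps / 4) + X ^+ 2 / eps * objective (hat s).
  apply: le_trans (proj_cost_competitor Ci Ce chi_gt0 eta0 (hat s) h) _.
  have : (n + 2 * m) * ln d / eta <= eps / 2 by rewrite ler_pdivrMr// [eps / 2 * _]mulrC.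
  set o := objective _.
  have o0 : 0 <= o by exact: objective_ge0.
  (* Completing the square trades the root for a multiple of [o], whose expectation the drift
     controls. *)
  have : X * Num.sqrt o <= eps / 4 + X ^+ 2 / eps * o.
    rewrite -{2}(sqr_sqrtr o0) -subr_ge0.
    have -> : eps / 4 + X ^+ 2 / eps * Num.sqrt o ^+ 2 - X * Num.sqrt o =
      (eps / 2 - X * Num.sqrt o) ^+ 2 / eps by field; rewrite gt_eqF.
    by rewrite divr_ge0 ?sqr_ge0// ltW.
  rewrite /X /M; lra.
apply: le_trans (expect_le p_ge0 pointwise) _.
rewrite expectD expect_cst// expectZ -!addrA !lerD2l.
suff : X ^+ 2 / eps * expect p (fun s => objective (hat s)) <= eps / 4 by lra.
(* The potential drops by at most [2 * eta * Cinf * M] plus an entropy term of at most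
   [eta * Cinf * M]; the factor [8 * m] comes from the drift. *)
have avg : K%:R * expect p (fun s : K.-tuple B => objective (hat s))
    <= 24 * m * (eta * (M * Cinf)).
  have := expect_drift p_ge0 p1 (drift eta0 E_gt0) K (lam0 R (E := E) (chi := chi)).
  move/le_trans => /(_ _ (pot0_le src tgt Ci Ce chi_gt0 eta0)) total.
  have m8 : 0 <= (8 * m)^-1 by rewrite invr_ge0 mulr_ge0 ?ler0n.
  have low : - (eta * (Cinf * M)) + (8 * m)^-1 * (K%:R * expect p (fun s => objective (hat s)))
      <= eta * (Cinf * M) + (n + 2 * m) * ln d.
    apply: le_trans total; rewrite -!expectZ -[X in X + _](expect_cst p1 K) -expectD.
    apply: expect_le => // s; apply: lerD.
      exact: pot_ge.
    rewrite -mulr_suml mulrC ler_wpM2r//.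
    rewrite (_ : K%:R * _ = \sum_(k < K) objective (hat s)); last first.
      by rewrite sum_cst card_ord.
    apply: ler_sum => k _.
    (* The output is minimal among [K + 1] iterates, of which the drift sums the first [K]. *)
    exact: (argmin s (widen_ord (leqnSn K) k)).
  have : eta * (eps / 2) <= eta * (Cinf * M).
    by rewrite ler_pM2l//; lra.
  have e8 : 8 * m * ((8 * m)^-1 * (K%:R * expect p (fun s => objective (hat s)))) =
     K%:R * expect p (fun s => objective (hat s)).
    by rewrite mulrA divff ?mul1r// gt_eqF// mulr_gt0.
  rewrite -e8 => h1.
  rewrite (_ : 24 * m * (eta * (M * Cinf)) = 8 * m * (3 * (eta * (Cinf * M)))); last ring.
  rewrite ler_pM2l ?mulr_gt0//; lra.
rewrite -(ler_pM2l K0) mulrCA.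
apply: (@le_trans _ _ (X ^+ 2 / eps * (24 * m * (eta * (M * Cinf))))).
  by rewrite ler_wpM2l// divr_ge0 ?sqr_ge0// ltW.
(* An equality: [8 ^+ 2] comes from [X], 24 from [avg], and 16 from the 4 in [eta] and the 4 in
   [eps / 4]. *)
apply: (@le_trans _ _
  ((8 ^+ 2 * 24 * 16 * m * d ^+ 2 * M ^+ 4 * Cinf ^+ 3 * eps ^- 3 * ln d) * (eps / 4))).
  rewrite le_eqVlt; apply/orP; left; apply/eqP.
  by rewrite /X /eta; field; rewrite gt_eqF.
by rewrite ler_wpM2r// divr_ge0// ltW.
Qed.

End Main.

Theorem theorem1 :
  exists c : Rdefinitions.R, 0 < c /\
  forall (V E chi : finType) (src tgt : E -> V),
    graph_ok src tgt -> (2 <= #|chi|)%N ->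
  forall (Ci : V -> chi -> Rdefinitions.R) (Ce : E -> chi -> chi -> Rdefinitions.R)
         (eps : Rdefinitions.R),
    0 < eps ->
  let n : Rdefinitions.R := #|V|%:R in
  let m : Rdefinitions.R := #|E|%:R in
  let d : Rdefinitions.R := #|chi|%:R in
  let eta := 4 * (m + n) * ln d / eps in
  forall K : nat,
    c * m * d ^+ 2 * (m + n) ^+ 4 * Cinf Ci Ce ^+ 3 * eps ^-3 * ln d <= K%:R ->
    mp_guarantee src tgt Ci Ce eta (emp_update src tgt Ci Ce eta)
      (fun _ => (2 * m)^-1) K eps
    /\ mp_guarantee src tgt Ci Ce eta (smp_update src tgt Ci Ce eta)
      (fun i => (nbr src tgt i)%:R / (\sum_(j : V) (nbr src tgt j)%:R)) K eps.
Proof.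
exists (8 ^+ 2 * 24 * 16); split; first by rewrite !mulr_gt0 ?exprn_gt0.
move=> V E chi src tgt graph chi2 Ci Ce eps eps0 n m d eta K hK.
have no_loop : forall e, src e != tgt e by case: graph.
have m2 : (0 < #|E|)%N -> 2 * m != 0.
  by move=> E0; rewrite mulf_neq0// pnatr_eq0 -?lt0n.
split; apply: drift_guarantee => //.
- by move=> _; rewrite invr_ge0 mulr_ge0// ler0n.
- move=> E0; rewrite sum_cst card_prod card_bool natrM [_ * 2]mulrC divff//.
  exact: m2.
- by move=> eta0; apply: emp_drift => //; exact: ltnW.
- by move=> i; rewrite divr_ge0 ?ler0n// sumr_ge0.
- by move=> E0; rewrite -mulr_suml divff// sum_nbr//; exact: m2.
- by move=> eta0; apply: smp_drift => //; exact: ltnW.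
Qed.
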